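(* Let $N,M\in\mathbb N$ and let $U:\mathbb C^N\to\mathbb C^{N+M}$ be a linear operator such that $U^*U=I+\sum_{n=1}^M\theta_{f_n,f_n}$ for some $f_1,f_2,\ldots,f_M\in\mathbb C^N$. Let $$f_n^{(0)}=f_n,\qquad\forall n=1,\ldots,M,$$ and, for $k=1,\ldots,M$, $$f_n^{(k)}=\left(I+\theta_{f_k^{(k-1)},f_k^{(k-1)}}\right)^{-\frac12}f_n^{(k-1)},\qquad\forall n=1,\ldots,M.$$ Consider the operators $$R_k^{(k-1)}=\left(I+\theta_{f_k^{(k-1)},f_k^{(k-1)}}\right)^{-\frac12},\qquad\forall k=1,\ldots,M,$$ and $$R=R_M^{(M-1)}R_{M-1}^{(M-2)}\cdots R_1^{(0)}.$$ Then $R$ is an invertible operator such that $UR^*$ is an isometry.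
   Context: $\mathbb N=\{1,2,\ldots\}$. For $x,y\in\mathbb C^N$ (standard inner product, linear in the first argument), $\theta_{x,y}$ is the operator $\theta_{x,y}(v)=\langle v,y\rangle x$. For a positive invertible operator $S$, $S^{-\frac12}$ denotes the inverse of its positive square root. *)

(* Defs.v *)
From mathcomp Require Export all_boot all_order all_algebra.
From mathcomp Require Export boolp classical_sets reals.
From mathcomp Require Export complex.
Set Implicit Arguments.
Unset Strict Implicit.
Unset Printing Implicit Defensive.
Import Order.TTheory GRing.Theory Num.Theory.
Export spectral.
Local Open Scope ring_scope.
Local Open Scope sesquilinear_scope.

(* Vectors are columns, a linear operator C^n -> C^m is the m x n matrix
   acting by [*m], and its adjoint is the conjugate transpose [^t*]
   (see [inner_adj]). *)

Section Hilbert.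
Variable C : numClosedFieldType.

(* [dotmx] is defined on rows; it is linear in its first argument. *)
Definition inner n (x y : 'cV[C]_n) : C := dotmx x^T y^T.

Definition norm2 n (x : 'cV[C]_n) : C := sqrtC (inner x x).

Definition theta m n (x : 'cV[C]_m) (y : 'cV[C]_n) : 'M[C]_(m, n) :=
  x *m y ^t*.

Lemma thetaE m n (x : 'cV[C]_m) (y v : 'cV[C]_n) :
  theta x y *m v = inner v y *: x.
Proof.
rewrite /theta /inner dotmxE -mulmxA; apply/colP => i.
rewrite !mxE big_ord1 mulrC !mxE; congr (_ * _).
by apply: eq_bigr => j _; rewrite !mxE mulrC.
Qed.

Lemma innerE n (x y : 'cV[C]_n) : inner x y = \sum_i x i 0 * (y i 0)^*.
Proof.
by rewrite /inner dotmxE mxE; apply: eq_bigr => i _; rewrite !mxE.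
Qed.

Lemma inner_adj m n (A : 'M[C]_(m, n)) (x : 'cV[C]_n) (y : 'cV[C]_m) :
  inner (A *m x) y = inner x (A ^t* *m y).
Proof.
rewrite !innerE.
under eq_bigr => i _ do rewrite mxE mulr_suml.
rewrite exchange_big /=; apply: eq_bigr => j _.
rewrite mxE rmorph_sum mulr_sumr; apply: eq_bigr => i _.
by rewrite !mxE rmorphM /= conjCK mulrCA mulrA.
Qed.

Definition posmx n (A : 'M[C]_n) : Prop :=
  forall v : 'cV[C]_n, 0 <= inner (A *m v) v.

(* The positive square root; the choice is only meaningful when [A] is
   positive, in which case exactly one [B] qualifies. *)
Definition sqrtmx n (A : 'M[C]_n) : 'M[C]_n :=
  xget 0 [set B : 'M[C]_n | posmx B /\ B *m B = A].

Definition invsqrtmx n (A : 'M[C]_n) : 'M[C]_n := invmx (sqrtmx A).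

Definition isometry_mx m n (A : 'M[C]_(m, n)) : Prop :=
  forall v : 'cV[C]_n, norm2 (A *m v) = norm2 v.

(* Families are indexed from 1 as in f_1, ..., f_M; values of [f] at other
   indices are never relevant. [iterate f k n] is f_n^(k). *)
Fixpoint iterate N (f : nat -> 'cV[C]_N) (k n : nat) : 'cV[C]_N :=
  if k is k'.+1 then
    invsqrtmx (1%:M + theta (iterate f k' k) (iterate f k' k))
      *m iterate f k' n
  else f n.

(* R_k^(k-1), for k >= 1 *)
Definition Rfactor N (f : nat -> 'cV[C]_N) (k : nat) : 'M[C]_N :=
  invsqrtmx (1%:M + theta (iterate f k.-1 k) (iterate f k.-1 k)).

(* R_M^(M-1) *m ... *m R_1^(0) *)
Definition Rprod N (f : nat -> 'cV[C]_N) (M : nat) : 'M[C]_N :=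
  \big[mulmx/1%:M]_(k <- rev (iota 1 M)) Rfactor f k.

End Hilbert.

(* Main.v *)
(** Write [S_k = I + theta_{g,g}] with [g = f_k^(k-1)] and [P_k = R_k ... R_1].
    Since [f_n^(k) = P_k f_n], conjugating [I + sum_{n <= k} theta_{f_n,f_n}] by
    [P_{k-1}] collapses all but the last rank-one term and leaves [S_k], which
    conjugation by [R_k = S_k^(-1/2)] turns into [I].  Hence
    [P_M (U^* U) P_M^* = I]. *)

Require Import Defs.
From mathcomp Require Import ring.
Set Implicit Arguments.
Unset Strict Implicit.
Unset Printing Implicit Defensive.
Import Order.TTheory GRing.Theory Num.Theory.
Local Open Scope ring_scope.
Local Open Scope sesquilinear_scope.

Section Operators.
Variable C : numClosedFieldType.

Lemma adjmxM m n p (A : 'M[C]_(m, n)) (B : 'M[C]_(n, p)) :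
  (A *m B) ^t* = B ^t* *m A ^t*.
Proof. by rewrite trmx_mul map_mxM. Qed.

Lemma adjmx1 n : (1%:M : 'M[C]_n) ^t* = 1%:M.
Proof. by rewrite trmx1 map_mx1. Qed.

Lemma inner_ge0 n (x : 'cV[C]_n) : 0 <= inner x x.
Proof. by rewrite innerE; apply: sumr_ge0 => i _; rewrite mul_conjC_ge0. Qed.

Lemma innerDl n (x y z : 'cV[C]_n) : inner (x + y) z = inner x z + inner y z.
Proof.
by rewrite !innerE -big_split; apply: eq_bigr => i _; rewrite mxE mulrDl.
Qed.

Lemma innerZl n a (x y : 'cV[C]_n) : inner (a *: x) y = a * inner x y.
Proof. by rewrite !innerE mulr_sumr; apply: eq_bigr => i _; rewrite mxE mulrA. Qed.

Lemma inner_conj n (x y : 'cV[C]_n) : (inner x y)^* = inner y x.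
Proof.
rewrite !innerE rmorph_sum; apply: eq_bigr => i _.
by rewrite rmorphM /= conjCK mulrC.
Qed.

Lemma innerDr n (x y z : 'cV[C]_n) : inner z (x + y) = inner z x + inner z y.
Proof. by rewrite -inner_conj innerDl rmorphD /= !inner_conj. Qed.

Lemma innerZr n a (x y : 'cV[C]_n) : inner x (a *: y) = a^* * inner x y.
Proof. by rewrite -inner_conj innerZl rmorphM /= inner_conj. Qed.

Lemma inner_delta m n (A : 'M[C]_(m, n)) i j :
  inner (A *m delta_mx j 0) (delta_mx i 0) = A i j.
Proof.
rewrite -colE innerE (bigD1 i) //= big1 ?addr0 => [|k /negPf ki].
  by rewrite !mxE !eqxx /= rmorph1 mulr1.
by rewrite !mxE ki /= rmorph0 mulr0.
Qed.

Lemma isometry_adjmx m n (A : 'M[C]_(m, n)) :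
  A ^t* *m A = 1%:M -> isometry_mx A.
Proof. by move=> AA v; rewrite /norm2 inner_adj mulmxA AA mul1mx. Qed.

(* Polarization at [v + w] and [v + 'i w]. *)
Lemma form_eq0 n (A : 'M[C]_n) :
  (forall v : 'cV[C]_n, inner (A *m v) v = 0) -> A = 0.
Proof.
move=> A0; apply/matrixP => i j; rewrite mxE -inner_delta.
set v : 'cV[C]_n := delta_mx i 0; set w : 'cV[C]_n := delta_mx j 0.
have E1 := A0 (w + v); have E2 := A0 (w + 'i *: v).
rewrite mulmxDr innerDl !innerDr !A0 add0r addr0 in E1.
rewrite mulmxDr innerDl !innerDr -!scalemxAr !innerZl !innerZr !A0 in E2.
rewrite !mulr0 add0r addr0 conjCi mulNr addrC -mulrBr in E2.
move/eqP: E2; rewrite mulf_eq0 (negPf (neq0Ci C)) /= subr_eq0 => /eqP E2.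
by move/eqP: E1; rewrite E2 -mulr2n mulrn_eq0 /= => /eqP.
Qed.

(** A nonnegative quadratic form is real, hence equal to its conjugate, which is the form of the
    adjoint; [form_eq0] applied to the difference concludes. *)
Lemma posmx_adj n (A : 'M[C]_n) : posmx A -> A ^t* = A.
Proof.
move=> Apos; apply/esym/eqP; rewrite -subr_eq0; apply/eqP/form_eq0 => v.
rewrite mulmxBl -scaleN1r innerDl innerZl mulN1r -(inner_conj v (A ^t* *m v)) -inner_adj.
by rewrite (CrealP (ger0_real (Apos v))) subrr.
Qed.

Lemma theta_sqr n (g : 'cV[C]_n) :
  theta g g *m theta g g = inner g g *: theta g g.
Proof. by rewrite {2}/theta mulmxA thetaE -scalemxAl. Qed.

Lemma posmx_1Dtheta n (g : 'cV[C]_n) c :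
  0 <= c -> posmx (1%:M + c *: theta g g).
Proof.
move=> c0 v; rewrite mulmxDl mul1mx -scalemxAl thetaE !innerDl !innerZl.
by rewrite addr_ge0 ?inner_ge0 // mulr_ge0 // -(inner_conj v g) mul_conjC_ge0.
Qed.

(** Since [theta g g] squares to a multiple of itself, these operators multiply through their
    coefficients alone, so finding an inverse or a square root becomes a scalar equation. *)
Lemma mul_1Dtheta n (g : 'cV[C]_n) a b :
  (1%:M + a *: theta g g) *m (1%:M + b *: theta g g) =
  1%:M + (a + b + a * b * inner g g) *: theta g g.
Proof.
rewrite mulmxDl !mulmxDr !mul1mx mulmx1 -scalemxAl -scalemxAr theta_sqr !scalerA.
by rewrite -!addrA -!scalerDl; congr (_ + _ *: _); ring.
Qed.

Lemma unitmx_1Dtheta n (g : 'cV[C]_n) : 1%:M + theta g g \in unitmx.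
Proof.
have t0 : 1 + inner g g != 0 by rewrite gt_eqF // ltr_wpDr ?inner_ge0.
(* Sherman-Morrison: the coefficient [b] of the inverse solves [1 + b + b * inner g g = 0]. *)
suff /mulmx1_unit[] : (1%:M + theta g g) *m
    (1%:M + (- (1 + inner g g)^-1) *: theta g g) = 1%:M by [].
rewrite -{1}[theta g g]scale1r mul_1Dtheta.
rewrite (_ : 1 + _ + _ = 0) ?scale0r ?addr0 //.
by field.
Qed.

(* The root is [1 + theta / (1 + s)] with [s = sqrt (1 + <g, g>)]. *)
Lemma sqrtmx_1Dtheta n (g : 'cV[C]_n) (B := sqrtmx (1%:M + theta g g)) :
  posmx B /\ B *m B = 1%:M + theta g g.
Proof.
pose s := sqrtC (1 + inner g g).
have s0 : 0 <= s by rewrite sqrtC_ge0 addr_ge0 ?inner_ge0.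
have s1 : 1 + s != 0 by rewrite gt_eqF // ltr_wpDr.
(* Either [xget] returns a root, or it falls back to [0] because none exists, which the explicit
   root refutes. *)
rewrite /B /sqrtmx; case: xgetP => [_ -> //|/(_ (1%:M + (1 + s)^-1 *: theta g g))].
case; split; first by apply: posmx_1Dtheta; rewrite invr_ge0 addr_ge0.
have -> : 1%:M + theta g g = 1%:M + 1 *: theta g g by rewrite scale1r.
rewrite mul_1Dtheta; congr (_ + _ *: _).
(* With [c = (1 + s)^-1], the equation [2 c + c^2 (s^2 - 1) = 1] remains. *)
have -> : inner g g = s ^+ 2 - 1 by rewrite sqrtCK addrC addKr.
by field.
Qed.

(** The root is invertible because its square is, and self-adjoint because it is positive; so
    conjugating by its inverse cancels one root on each side. *)
Lemma invsqrtmx_1Dtheta n (g : 'cV[C]_n) (B := invsqrtmx (1%:M + theta g g)) :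
  B \in unitmx /\ B *m (1%:M + theta g g) *m B ^t* = 1%:M.
Proof.
rewrite /B /invsqrtmx; have [Bpos BB] := sqrtmx_1Dtheta g.
set A := sqrtmx _ in Bpos BB *.
have Au : A \in unitmx by move: (unitmx_1Dtheta g); rewrite -BB unitmx_mul andbb.
split; first by rewrite unitmx_inv.
have -> : (invmx A) ^t* = invmx A by rewrite trmx_inv map_invmx posmx_adj.
by rewrite -BB mulKmx // mulmxV.
Qed.

Lemma conj_theta m n (A : 'M[C]_(m, n)) (g : 'cV[C]_n) :
  A *m theta g g *m A ^t* = theta (A *m g) (A *m g).
Proof. by rewrite /theta adjmxM !mulmxA. Qed.

Section Iteration.
Variables (N : nat) (f : nat -> 'cV[C]_N).

Lemma RprodS k : Rprod f k.+1 = Rfactor f k.+1 *m Rprod f k.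
Proof. by rewrite /Rprod -{1}(addn1 k) iotaD rev_cat big_cons add1n. Qed.

(** The factor applied at each stage is the same for every index [n], so one product serves the
    whole family. *)
Lemma iterateE k n : iterate f k n = Rprod f k *m f n.
Proof.
elim: k n => [|k IH] n; first by rewrite /Rprod big_nil mul1mx.
by rewrite RprodS -mulmxA -IH.
Qed.

Lemma Rprod_unitmx k : Rprod f k \in unitmx.
Proof.
elim: k => [|k IH]; first by rewrite /Rprod big_nil unitmx1.
by rewrite RprodS unitmx_mul IH andbT; case: (invsqrtmx_1Dtheta (iterate f k k.+1)).
Qed.

Lemma Rprod_conj k :
  Rprod f k *m (1%:M + \sum_(1 <= n < k.+1) theta (f n) (f n)) *m (Rprod f k) ^t*
  = 1%:M.
Proof.
elim: k => [|k IH].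
  by rewrite /Rprod big_nil big_geq // addr0 !mul1mx adjmx1.
have [_ RSR] := invsqrtmx_1Dtheta (iterate f k k.+1).
(* Regrouping puts the conjugation by [Rprod f k] inside that by [Rfactor f k.+1], with the last
   rank-one term split off for [IH]. *)
rewrite RprodS adjmxM !mulmxA -!(mulmxA (Rfactor f k.+1)) big_nat_recr //= addrA.
by rewrite (mulmxDr (Rprod f k)) mulmxDl IH conj_theta -iterateE mulmxA.
Qed.

End Iteration.
End Operators.

Theorem theorem4p16 (R : realType) (N M : nat) (N_gt0 : (0 < N)%N)
    (M_gt0 : (0 < M)%N) (U : 'M[R[i]]_(N + M, N)) (f : nat -> 'cV[R[i]]_N)
    (hU : U ^t* *m U = 1%:M + \sum_(1 <= n < M.+1) theta (f n) (f n)) :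
  Rprod f M \in unitmx /\ isometry_mx (U *m (Rprod f M) ^t*).
Proof.
split; first exact: Rprod_unitmx.
(* With [P = Rprod f M], the Gram operator of [U *m P ^t*] is the conjugate of [U ^t* *m U] by
   [P]. *)
apply: isometry_adjmx; rewrite adjmxM trmxCK mulmxA -(mulmxA _ _ U) hU.
exact: Rprod_conj.
Qed.
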